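(* Let $X$ be a topological space, $(Y,\mathcal{U})$ a quasi-uniform space, $\mathcal{B}$ a cover of $Y$, and let $F_1,F_2:X\to 2^Y$ be multifunctions which are $\mathcal{B}$-lsc at $x_0\in X$. Then the union multifunction $F=F_1\cup F_2$, defined by $F(x)=F_1(x)\cup F_2(x)$ for $x\in X$, is $\mathcal{B}$-lsc at $x_0$.
   Context: $2^Y$ is the family of all subsets of $Y$ (including $\emptyset$); a multifunction from $X$ to $Y$ is a map $F:X\to 2^Y$. A quasi-uniformity on $Y$ is a family $\mathcal{U}$ of subsets of $Y\times Y$ such that: every $U\in\mathcal{U}$ contains the diagonal; $U,V\in\mathcal{U}$ implies $U\cap V\in\mathcal{U}$; for every $U\in\mathcal{U}$ there is $V\in\mathcal{U}$ with $V\circ V\subset U$, where $V\circ V=\{(x,y):(x,z),(z,y)\in V\text{ for some }z\in Y\}$; and $U\in\mathcal{U}$, $U\subset V\subset Y\times Y$ implies $V\in\mathcal{U}$. The pair $(Y,\mathcal{U})$ is a quasi-uniform space. Put $W^{-1}=\{(z,y):(y,z)\in W\}$ and, for $A\subset Y$, $W^{-1}(A)=\{y\in Y:(z,y)\in W^{-1}\text{ for some }z\in A\}$. A cover of $Y$ is a family $\mathcal{B}$ of nonempty subsets of $Y$ with $\bigcup\mathcal{B}=Y$. $F$ is $\mathcal{B}$-lsc at $x_0$ if for every $W\in\mathcal{U}$ and every $B\in\mathcal{B}$ there is a neighbourhood $U(x_0)$ of $x_0$ such that $F(x_0)\cap B\subset W^{-1}(F(x))$ for every $x\in U(x_0)$.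 *)

(* Defs.v *)
From mathcomp Require Import all_boot all_classical.
From mathcomp Require Import topology.

Set Implicit Arguments.
Unset Strict Implicit.
Unset Printing Implicit Defensive.

Local Open Scope classical_set_scope.

Definition multifunction (X Y : Type) : Type := X -> set Y.

Definition multifunction_union (X Y : Type) (F1 F2 : multifunction X Y) :
    multifunction X Y :=
  fun x => F1 x `|` F2 x.

(* As usual for quasi-uniformities there is no symmetry axiom, so mathcomp's
   uniformType cannot be used. *)
Record quasi_uniformity (Y : Type) (UU : set (set (Y * Y))) : Prop :=
  QuasiUniformity {
    quniform_diagonal : forall U, UU U -> diagonal `<=` U ;
    quniformI : forall U V, UU U -> UU V -> UU (U `&` V) ;
    quniform_split :
      forall U, UU U -> exists2 V, UU V & (V \; V)%relation `<=` U ;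
    quniform_upward : forall U V, UU U -> U `<=` V -> UU V
  }.

Definition set_cover (Y : Type) (BB : set (set Y)) : Prop :=
  (forall B, BB B -> B !=set0) /\ cover BB id = [set: Y].

Definition rel_image (Y : Type) (R : set (Y * Y)) (A : set Y) : set Y :=
  [set y | exists2 z, A z & R (z, y)].

Definition cover_lsc (X : topologicalType) (Y : Type) (UU : set (set (Y * Y)))
    (BB : set (set Y)) (F : multifunction X Y) (x0 : X) : Prop :=
  forall W, UU W -> forall B, BB B ->
  exists2 N, nbhs x0 N &
    forall x, N x -> F x0 `&` B `<=` rel_image (W^-1)%relation (F x).

(* Main.v *)
Require Import Defs.
From mathcomp Require Import all_boot all_classical.
From mathcomp Require Import topology.

(** The image [rel_image (W^-1)%relation A] grows with [A], and intersecting with [B] distributes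
    over the union. For fixed [W] and [B], both inclusions therefore hold together on the
    intersection of the two given neighbourhoods. *)

Theorem theorem3p1 (X : topologicalType) (Y : Type) (UU : set (set (Y * Y)))
    (BB : set (set Y)) (F1 F2 : multifunction X Y) (x0 : X)
    (hUU : quasi_uniformity UU) (hBB : set_cover BB)
    (hF1 : cover_lsc UU BB F1 x0) (hF2 : cover_lsc UU BB F2 x0) :
  cover_lsc UU BB (multifunction_union F1 F2) x0.
Proof.
move=> W UW B BBB.
have [N1 nN1 sub1] := hF1 _ UW _ BBB.
have [N2 nN2 sub2] := hF2 _ UW _ BBB.
exists (setI N1 N2); first exact: filterI.
move=> x [N1x N2x] y [[F1y|F2y] By].
(* Monotonicity of the image: the witness [z] in [F1 x] also lies in the union at [x], with the same
   [W]. *)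
- by have [z F1z Wz] := sub1 _ N1x _ (conj F1y By); exists z => //; left.
- by have [z F2z Wz] := sub2 _ N2x _ (conj F2y By); exists z => //; right.
Qed.
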